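(* Let $\mathbb{F}$ be a division ring, $n$ a positive integer, $\sigma:\mathbb{F}\to\mathbb{F}^{n\times n}$ a ring morphism and $\delta:\mathbb{F}\to\mathbb{F}^n$ a $\sigma$-derivation. For all $\mathbf{a}\in\mathbb{F}^n$, $\beta\in\mathbb{F}^*$ and $F\in\mathbb{F}[\mathbf{x};\sigma,\delta]$, it holds that $$F\left(\mathcal{D}_{\mathbf{a}}(\beta)\beta^{-1}\right)=F^{\mathcal{D}_{\mathbf{a}}}(\beta)\,\beta^{-1},$$ where the left-hand side is the skew (remainder-based) evaluation of $F$ at the point $\mathcal{D}_{\mathbf{a}}(\beta)\beta^{-1}\in\mathbb{F}^n$, and $F^{\mathcal{D}_{\mathbf{a}}}(\beta)$ is the linearized evaluation.
   Context: Rings are associative with identity, not necessarily commutative, and ring morphisms preserve identities. $\mathbb{F}^*=\mathbb{F}\setminus\{0\}$ and $\mathbb{F}^n$ denotes column vectors. A map $\delta:\mathbb{F}\to\mathbb{F}^n$ is a $\sigma$-derivation if $\delta(a+b)=\delta(a)+\delta(b)$ and $\delta(ab)=\sigma(a)\delta(b)+\delta(a)b$ for all $a,b\in\mathbb{F}$. Free skew polynomial ring: let $\mathcal{M}$ be the free monoid on pairwise distinct variables $x_1,\dots,x_n$ (elements are called monomials). $\mathbb{F}[\mathbf{x};\sigma,\delta]$ is the left $\mathbb{F}$-vector space with basis $\mathcal{M}$, with the ring product given by concatenating monomials and $x_i a=\sum_{j=1}^n\sigma_{i,j}(a)x_j+\delta_i(a)$ for $a\in\mathbb{F}$, $i=1,\dots,n$.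 Skew evaluation: for $\mathbf{a}=(a_1,\dots,a_n)\in\mathbb{F}^n$, $F(\mathbf{a})$ is the unique element of $\mathbb{F}$ such that $F-F(\mathbf{a})$ belongs to the left ideal of $\mathbb{F}[\mathbf{x};\sigma,\delta]$ generated by $x_1-a_1,\dots,x_n-a_n$. Linearized evaluation: define $\mathcal{D}_{\mathbf{a}}:\mathbb{F}\to\mathbb{F}^n$ by $\mathcal{D}_{\mathbf{a}}(\beta)=\sigma(\beta)\mathbf{a}+\delta(\beta)$. Define maps $\mathcal{D}_{\mathbf{a}}^{\mathfrak{m}}:\mathbb{F}\to\mathbb{F}$ for $\mathfrak{m}\in\mathcal{M}$ recursively by $\mathcal{D}_{\mathbf{a}}^{1}=\mathrm{Id}$ and $\mathcal{D}_{\mathbf{a}}^{x_i\mathfrak{m}}(\beta)=$ the $i$-th component of $\mathcal{D}_{\mathbf{a}}(\mathcal{D}_{\mathbf{a}}^{\mathfrak{m}}(\beta))$. For $F=\sum_{\mathfrak{m}}F_{\mathfrak{m}}\mathfrak{m}$ set $F^{\mathcal{D}_{\mathbf{a}}}=\sum_{\mathfrak{m}}F_{\mathfrak{m}}\mathcal{D}_{\mathbf{a}}^{\mathfrak{m}}$, a map $\mathbb{F}\to\mathbb{F}$, $\beta\mapsto\sum_{\mathfrak{m}}F_{\mathfrak{m}}\mathcal{D}_{\mathbf{a}}^{\mathfrak{m}}(\beta)$. *)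

(* Defs.v *)
From HB Require Import structures.
From mathcomp Require Import all_boot all_order all_algebra.
From mathcomp Require Import finmap.
From mathcomp.multinomials Require Import monalg.

Set Implicit Arguments.
Unset Strict Implicit.
Unset Printing Implicit Defensive.

Import GRing.Theory.
Local Open Scope ring_scope.

(* [msum h] is the additive extension to {malg G[K]} of the maps [h k]. *)
Section MalgSum.
Variables (K : choiceType) (G V : zmodType) (h : K -> G -> V).
Hypothesis hD : forall k, {morph h k : x y / x + y}.

Definition msum (g : {malg G[K]}) : V := \sum_(k <- msupp g) h k g@_k.

Let h0 k : h k 0 = 0.
Proof. by apply: (addrI (h k 0)); rewrite -hD !addr0. Qed.

Lemma msumw (d : {fset K}) g :
  (msupp g `<=` d)%fset -> msum g = \sum_(k <- d) h k g@_k.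
Proof.
by move=> le; apply: big_fset_incl => // k _ /mcoeff_outdom ->.
Qed.

Lemma msumD : {morph msum : g1 g2 / g1 + g2}.
Proof.
move=> g1 g2; rewrite (msumw (msuppD_le g1 g2)).
rewrite (msumw (fsubsetUl (msupp g1) (msupp g2))).
rewrite (msumw (fsubsetUr (msupp g1) (msupp g2))) -big_split /=.
by apply: eq_bigr => k _; rewrite mcoeffD hD.
Qed.

Lemma msum0 : msum 0 = 0.
Proof. by apply: (addrI (msum 0)); rewrite -msumD !addr0. Qed.

Lemma msumN : {morph msum : g / - g}.
Proof. by move=> g; apply: (addrI (msum g)); rewrite -msumD !subrr msum0. Qed.

Lemma msumB : {morph msum : g1 g2 / g1 - g2}.
Proof. by move=> g1 g2; rewrite msumD msumN. Qed.

Lemma msum_sum (I : Type) (r : seq I) (P : pred I) E :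
  msum (\sum_(i <- r | P i) E i) = \sum_(i <- r | P i) msum (E i).
Proof. exact: (big_morph _ msumD msum0). Qed.

Lemma msumU k x : msum (mkmalgU k x) = h k x.
Proof. by rewrite (msumw msuppU_le) big_seq_fset1 mcoeffUU. Qed.
End MalgSum.

Lemma malg_ind_add (K : choiceType) (G : zmodType) (Q : {malg G[K]} -> Prop) :
  Q 0 -> (forall g1 g2, Q g1 -> Q g2 -> Q (g1 + g2)) ->
  (forall k x, Q (mkmalgU k x)) -> forall g, Q g.
Proof. by move=> Q0 QD QU g; rewrite [g]monalgE; apply: big_ind. Qed.

Section LeftIdeal.
Variable R : pzRingType.

Record left_ideal (I : R -> Prop) : Prop := LeftIdeal {
  left_ideal0 : I 0;
  left_idealB : forall x y, I x -> I y -> I (x - y);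
  left_idealM : forall r x, I x -> I (r * x) }.

Definition left_ideal_gen (S : R -> Prop) (x : R) : Prop :=
  forall I : R -> Prop, left_ideal I -> (forall s, S s -> I s) -> I x.

Lemma left_ideal_genP S : left_ideal (left_ideal_gen S).
Proof.
split=> [|x y hx hy|r x hx] I hI hS.
- exact: left_ideal0 hI.
- by apply: (left_idealB hI); [apply: hx | apply: hy].
- by apply: (left_idealM hI); apply: hx.
Qed.

Lemma left_ideal_gen_in (S : R -> Prop) s : S s -> left_ideal_gen S s.
Proof. by move=> hs I _; apply. Qed.

Lemma left_idealD I : left_ideal I -> forall x y, I x -> I y -> I (x + y).
Proof.
move=> hI x y hx hy; rewrite -[y]opprK.
by apply: (left_idealB hI) => //; rewrite -sub0r;
  apply: (left_idealB hI) => //; apply: left_ideal0 hI.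
Qed.
End LeftIdeal.

(* Scalars of column vectors act on the right: in 'cV[F]_n over a
   noncommutative F, [*:] is multiplication on the left. *)
Definition cv_mulr (F : pzRingType) (n : nat) (v : 'cV[F]_n) (b : F) : 'cV[F]_n :=
  \col_i (v i 0 * b).

Record sderivation (F : pzRingType) (n : nat) (sigma : F -> 'M[F]_n) :=
  SDerivation {
    sder_fun :> F -> 'cV[F]_n;
    sderD : forall a b, sder_fun (a + b) = sder_fun a + sder_fun b;
    sderM : forall a b,
      sder_fun (a * b) = sigma a *m sder_fun b + cv_mulr (sder_fun a) b }.

(* The left F-module on the monomials, encoded as words in the variable indices
   (the empty word is 1).  sigma and delta are phantom parameters of the type;
   they determine the skew product put on it below, which is not the product
   of monoid algebras. *)
Definition skew_poly (F : nzRingType) (n : nat) (sigma : F -> 'M[F]_n)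
  (delta : sderivation sigma) : Type := {malg F[seq 'I_n]}.

HB.instance Definition _ (F : nzRingType) (n : nat) (sigma : F -> 'M[F]_n)
  (delta : sderivation sigma) :=
  GRing.Lmodule.copy (skew_poly delta) {malg F[seq 'I_n]}.

Section SkewPoly.
Variables (F : nzRingType) (n : nat) (sigma : {rmorphism F -> 'M[F]_n}).
Variable delta : sderivation sigma.
Local Notation SP := (skew_poly delta).

Implicit Types (P Q : SP) (i j : 'I_n) (m : seq 'I_n) (a b : F).

(* x_i (a m) = \sum_j sigma_ij(a) x_j m + delta_i(a) m *)
Definition skew_varmul_mon i m a : SP :=
  \sum_j mkmalgU (j :: m) (sigma a i j) + mkmalgU m (delta a i 0).

Definition skew_varmul i P : SP := msum (skew_varmul_mon i) P.

Definition skew_mul P Q : SP :=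
  \sum_(m <- msupp P) P@_m *: foldr skew_varmul Q m.

Definition skew_one : SP := mkmalgU [::] 1.

Let varmul_monD i m : {morph skew_varmul_mon i m : a b / a + b}.
Proof.
move=> a b; rewrite /skew_varmul_mon rmorphD sderD mxE monalgUD.
rewrite addrACA -big_split; congr (_ + _); apply: eq_bigr => j _.
by rewrite mxE monalgUD.
Qed.

Lemma skew_varmulD i : {morph skew_varmul i : P Q / P + Q}.
Proof. exact: msumD. Qed.

Lemma skew_varmul0 i : skew_varmul i 0 = 0.
Proof. exact: msum0. Qed.

Lemma skew_varmulU i m a :
  skew_varmul i (mkmalgU m a) = skew_varmul_mon i m a.
Proof. exact: msumU. Qed.

Lemma sder1 : delta 1 = 0.
Proof.
have := sderM delta 1 1; rewrite mulr1 rmorph1.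
have -> : cv_mulr (delta 1) 1 = delta 1 by apply/colP => i; rewrite !mxE mulr1.
by rewrite mul1mx => /eqP; rewrite -subr_eq subrr eq_sym => /eqP.
Qed.

Let malgZU (c a : F) m : c *: (mkmalgU m a : SP) = mkmalgU m (c * a).
Proof. by apply/malgP => k; rewrite mcoeffZ !mcoeffU mulrnAr. Qed.

Lemma skew_varmulZ i a P : skew_varmul i (a *: P) =
  \sum_j sigma a i j *: skew_varmul j P + delta a i 0 *: P.
Proof.
elim/malg_ind_add: P => [|P Q hP hQ|m b].
- rewrite !(scaler0, skew_varmul0, addr0) big1 // => j _.
  by rewrite skew_varmul0 scaler0.
- rewrite [a *: (P + Q)]scalerDr [LHS]skew_varmulD hP hQ.
  rewrite [delta a i 0 *: (P + Q)]scalerDr [LHS]addrACA.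
  congr (_ + _); rewrite -[LHS]big_split; apply: eq_bigr => j _ /=.
  by rewrite -[LHS]scalerDr -skew_varmulD.
- rewrite malgZU skew_varmulU /skew_varmul_mon rmorphM sderM /= !mxE monalgUD.
  rewrite addrA malgZU; congr (_ + _).
  under [RHS]eq_bigr => j _.
    rewrite skew_varmulU scalerDr scaler_sumr malgZU.
    under eq_bigr => k _ do rewrite malgZU.
    over.
  rewrite big_split /= exchange_big /= raddf_sum; congr (_ + _).
  by apply: eq_bigr => k _; rewrite mxE raddf_sum.
Qed.

Let mon_mulD P : forall m, {morph (fun a => a *: foldr skew_varmul P m)
   : a b / a + b}.
Proof. by move=> m a b; rewrite scalerDl. Qed.

Let mulE P Q : skew_mul P Q = msum (fun m a => a *: foldr skew_varmul Q m) P.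
Proof. by []. Qed.

Lemma skew_mulDl : left_distributive skew_mul +%R.
Proof. by move=> P1 P2 Q; rewrite !mulE msumD. Qed.

Let foldD m : {morph (fun P => foldr skew_varmul P m) : P Q / P + Q}.
Proof. by elim: m => //= i m IH P Q; rewrite IH skew_varmulD. Qed.

Lemma skew_mulDr : right_distributive skew_mul +%R.
Proof.
move=> P Q1 Q2; rewrite /skew_mul -big_split /=.
by apply: eq_bigr => m _; rewrite foldD scalerDr.
Qed.

Let mulU m a Q : skew_mul (mkmalgU m a) Q = a *: foldr skew_varmul Q m.
Proof. by rewrite mulE msumU. Qed.

Let mul0s Q : skew_mul 0 Q = 0.
Proof. by rewrite mulE msum0. Qed.

Lemma skew_scalerAl a P Q : a *: skew_mul P Q = skew_mul (a *: P) Q.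
Proof.
elim/malg_ind_add: P => [|P1 P2 h1 h2|m b].
- by rewrite mul0s !scaler0 mul0s.
- by rewrite skew_mulDl !scalerDr h1 h2 skew_mulDl.
- by rewrite malgZU !mulU scalerA.
Qed.

Let mul_sum (I : Type) (r : seq I) (E : I -> SP) Q :
  skew_mul (\sum_(i <- r) E i) Q = \sum_(i <- r) skew_mul (E i) Q.
Proof.
exact: (big_morph (fun P => skew_mul P Q)
  (fun P1 P2 => skew_mulDl P1 P2 Q) (mul0s Q)).
Qed.

Let varmulA i P Q : skew_varmul i (skew_mul P Q) = skew_mul (skew_varmul i P) Q.
Proof.
elim/malg_ind_add: P => [|P1 P2 h1 h2|m a].
- by rewrite mul0s !skew_varmul0 mul0s.
- by rewrite skew_mulDl !skew_varmulD h1 h2 skew_mulDl.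
- rewrite mulU skew_varmulZ skew_varmulU /skew_varmul_mon skew_mulDl mul_sum.
  by rewrite mulU; congr (_ + _); apply: eq_bigr => j _; rewrite mulU.
Qed.

Lemma skew_mulA : associative skew_mul.
Proof.
move=> P Q R; elim/malg_ind_add: P => [|P1 P2 h1 h2|m a].
- by rewrite !mul0s.
- by rewrite !skew_mulDl h1 h2.
- rewrite !mulU -skew_scalerAl; congr (_ *: _).
  by elim: m => //= i m ->; rewrite varmulA.
Qed.

Lemma skew_mul1l : left_id skew_one skew_mul.
Proof. by move=> P; rewrite mulU scale1r. Qed.

Let fold1 m : foldr skew_varmul skew_one m = mkmalgU m 1.
Proof.
elim: m => //= i m ->; rewrite skew_varmulU /skew_varmul_mon sder1 rmorph1 mxE.
rewrite monalgU0 addr0 (bigD1 i) //= big1 ?addr0 => [|j ne].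
  by rewrite mxE eqxx.
by rewrite mxE eq_sym (negPf ne) monalgU0.
Qed.

Lemma skew_mul1r : right_id skew_one skew_mul.
Proof.
move=> P; rewrite [RHS]monalgE; apply: eq_bigr => m _.
by rewrite fold1 malgZU mulr1.
Qed.

Lemma skew_one_neq0 : skew_one != 0.
Proof. by rewrite monalgU_eq0 oner_eq0. Qed.

HB.instance Definition _ := GRing.Zmodule_isNzRing.Build SP
  skew_mulA skew_mul1l skew_mul1r skew_mulDl skew_mulDr skew_one_neq0.

HB.instance Definition _ := GRing.Lmodule_isLalgebra.Build F SP
  skew_scalerAl.

Definition skew_mon m : SP := mkmalgU m 1.
Definition skew_var i : SP := skew_mon [:: i].

Lemma skew_polyE P : P = \sum_(m <- msupp P) P@_m *: skew_mon m.
Proof.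
by rewrite [LHS]monalgE; apply: eq_bigr => m _; rewrite malgZU mulr1.
Qed.

Lemma skew_monM m1 m2 : skew_mon m1 * skew_mon m2 = skew_mon (m1 ++ m2).
Proof.
rewrite -[LHS]/(skew_mul _ _) mulU scale1r /skew_mon.
by rewrite -(fold1 m2) -(fold1 (m1 ++ m2)) foldr_cat.
Qed.

Lemma skew_varM_scalar i a :
  skew_var i * a%:A =
  \sum_j (sigma a i j)%:A * skew_var j + (delta a i 0)%:A :> SP.
Proof.
rewrite -[LHS]/(skew_mul _ _) mulU scale1r /= skew_varmulZ; congr (_ + _).
apply: eq_bigr => j _; rewrite -scalerAl mul1r; congr (_ *: _).
by rewrite -[LHS]/(foldr skew_varmul skew_one [:: j]) fold1.
Qed.

Definition skewD (v : 'cV[F]_n) (b : F) : 'cV[F]_n := sigma b *m v + delta b.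

Fixpoint skewD_mon (v : 'cV[F]_n) (m : seq 'I_n) (b : F) : F :=
  if m is i :: m' then skewD v (skewD_mon v m' b) i 0 else b.

Definition lin_eval P (v : 'cV[F]_n) (b : F) : F :=
  \sum_(m <- msupp P) P@_m * skewD_mon v m b.

(* c is a remainder of P modulo the left ideal (x_1 - v_1, ..., x_n - v_n). *)
Definition skew_remainder P (v : 'cV[F]_n) (c : F) : Prop :=
  left_ideal_gen (fun L : SP => exists i, L = skew_var i - (v i 0)%:A)
    (P - c%:A).

Lemma lin_eval_mul P Q v b : lin_eval (P * Q) v b = lin_eval P v (lin_eval Q v b).
Proof.
have pD (Q' : F) : forall m, {morph (fun a => a * skewD_mon v m Q') : x y / x + y}.
  by move=> m x y; rewrite mulrDl.
pose ev (R : SP) c := msum (fun m a => a * skewD_mon v m c) R.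
have evD R1 R2 c : ev (R1 + R2) c = ev R1 c + ev R2 c by rewrite /ev msumD.
have evU m a c : ev (mkmalgU m a) c = a * skewD_mon v m c by rewrite /ev msumU.
have ev0 c : ev 0 c = 0 by rewrite /ev msum0.
have evs (I : Type) (r : seq I) (E : I -> SP) c :
    ev (\sum_(i <- r) E i) c = \sum_(i <- r) ev (E i) c.
  exact: (big_morph (fun R => ev R c) (fun R1 R2 => evD R1 R2 c) (ev0 c)).
have evZ a R c : ev (a *: R) c = a * ev R c.
  elim/malg_ind_add: R => [|R1 R2 h1 h2|m e].
  - by rewrite scaler0 ev0 mulr0.
  - by rewrite scalerDr !evD h1 h2 mulrDr.
  - by rewrite malgZU !evU mulrA.
have DD x y i : skewD v (x + y) i 0 = skewD v x i 0 + skewD v y i 0.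
  by rewrite /skewD rmorphD sderD mulmxDl addrACA mxE.
have D0 i : skewD v 0 i 0 = 0.
  by apply: (addrI (skewD v 0 i 0)); rewrite -DD !addr0.
have evX i R c : ev (skew_varmul i R) c = skewD v (ev R c) i 0.
  elim/malg_ind_add: R => [|R1 R2 h1 h2|m a].
  - by rewrite skew_varmul0 !ev0 D0.
  - by rewrite skew_varmulD !evD h1 h2 DD.
  - rewrite skew_varmulU /skew_varmul_mon evD evs !evU /skewD.
    rewrite rmorphM sderM -mulmxA addrA -mulmxDr !mxE; congr (_ + _).
    by apply: eq_bigr => j _; rewrite evU /=.
rewrite -[LHS]/(ev (P * Q) b) -[RHS]/(ev P (ev Q b)).
elim/malg_ind_add: P => [|P1 P2 h1 h2|m a].
- by rewrite mul0r !ev0.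
- by rewrite mulrDl !evD h1 h2.
- rewrite -[_ * Q]/(skew_mul (mkmalgU m a) Q) mulU evZ evU; congr (_ * _).
  by elim: m => //= i m <-; rewrite evX.
Qed.

Lemma lin_evalB v b : {morph (fun P => lin_eval P v b) : P Q / P - Q}.
Proof.
move=> P Q.
by rewrite /lin_eval -/(msum (fun m a => a * skewD_mon v m b) _) msumB
  // => m x y; rewrite mulrDl.
Qed.

Lemma lin_evalU m a v b : lin_eval (mkmalgU m a) v b = a * skewD_mon v m b.
Proof.
by rewrite /lin_eval -/(msum (fun m a => a * skewD_mon v m b) _) msumU
  // => k x y; rewrite mulrDl.
Qed.

Lemma lin_evalC c v b : lin_eval c%:A v b = c * b.
Proof. by rewrite [c%:A]malgZU mulr1 lin_evalU. Qed.

Lemma skew_remainder_lin P v : skew_remainder P v (lin_eval P v 1).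
Proof.
set S := fun L : SP => exists i, L = skew_var i - (v i 0)%:A.
have hI := left_ideal_genP S.
have telescope (V : zmodType) (x s d t : V) :
    x - (t + d) = x - (s + d) + (s - t).
  by rewrite -addrA !opprD [in RHS]addrACA addNr add0r [- t - d]addrC.
have mon m : skew_remainder (skew_mon m) v (skewD_mon v m 1).
  elim: m => [|i m IH]; rewrite /skew_remainder -/S.
    by rewrite scale1r subrr; apply: left_ideal0 hI.
  set c := skewD_mon v m 1 in IH *.
  have -> : skew_mon (i :: m) - (skewD_mon v (i :: m) 1)%:A =
     skew_var i * (skew_mon m - c%:A) +
     \sum_j (sigma c i j)%:A * (skew_var j - (v j 0)%:A).
    rewrite mulrBr skew_monM skew_varM_scalar /= -/c.
    have -> : \sum_j (sigma c i j)%:A * (skew_var j - (v j 0)%:A) =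
        \sum_j (sigma c i j)%:A * skew_var j - ((sigma c *m v) i 0)%:A.
      rewrite mxE scaler_suml -sumrB; apply: eq_bigr => j _.
      by rewrite mulrBr; congr (_ - _); rewrite -scalerAl mul1r scalerA.
    by rewrite [skewD _ _ _ _]mxE scalerDl; apply: telescope.
  apply: (left_idealD hI); first exact: (left_idealM hI).
  apply: big_ind => [|x y|j _]; [exact: left_ideal0 hI|exact: left_idealD|].
  by apply: (left_idealM hI); apply: left_ideal_gen_in; exists j.
rewrite /skew_remainder -/S [X in X - _]skew_polyE /lin_eval scaler_suml -sumrB.
apply: big_ind => [|x y|m _]; [exact: left_ideal0 hI|exact: left_idealD|].
rewrite -scalerA -scalerBr -[_ - _]mul1r scalerAl.
by apply: (left_idealM hI); apply: mon.
Qed.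

Lemma skew_remainder_uniq P v c : skew_remainder P v c -> c = lin_eval P v 1.
Proof.
move=> /(_ (fun L => lin_eval L v 1 = 0)).
rewrite lin_evalB lin_evalC mulr1 => h; apply/esym/eqP; rewrite -subr_eq0.
apply/eqP/h.
  split=> [|x y hx hy|r x hx].
  - by rewrite /lin_eval msupp0 big_seq_fset0.
  - by rewrite lin_evalB hx hy subrr.
  - rewrite lin_eval_mul hx /lin_eval big1 // => m _.
    suff -> : skewD_mon v m 0 = 0 by rewrite mulr0.
    have d0 : delta 0 = 0.
      by apply: (addrI (delta 0)); rewrite -sderD !addr0.
    by elim: m => //= i m ->; rewrite /skewD rmorph0 d0 mul0mx addr0 mxE.
move=> _ [i ->]; rewrite lin_evalB lin_evalC lin_evalU /= mul1r mulr1.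
by rewrite /skewD sder1 rmorph1 mul1mx addr0 subrr.
Qed.

Lemma skew_remainder_ex P v :
  {c | skew_remainder P v c & forall c', skew_remainder P v c' -> c' = c}.
Proof.
exists (lin_eval P v 1); first exact: skew_remainder_lin.
exact: skew_remainder_uniq.
Qed.

(* skew_eval does not compute: it is determined by skew_evalP and
   skew_eval_uniq. *)
Definition skew_eval P (v : 'cV[F]_n) : F := s2val (skew_remainder_ex P v).

Lemma skew_evalP P v : skew_remainder P v (skew_eval P v).
Proof. exact: s2valP. Qed.

Lemma skew_eval_uniq P v c : skew_remainder P v c -> c = skew_eval P v.
Proof. exact: (s2valP' (skew_remainder_ex P v)). Qed.

End SkewPoly.

Arguments skew_remainder_lin {F n sigma delta} P v : rename.
Arguments skew_evalP {F n sigma delta} P v : rename.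

(* Main.v *)
(** Write [v = D_a(beta) beta^-1].  The product rules for [sigma] and [delta]
    give the conjugation identity [D_v(c) beta = D_a(c beta)], which extends to
    [D_v^m(c) beta = D_a^m(c beta)] for every monomial [m].  Since the remainder
    of [P] at [v] is [P^{D_v}(1)], taking [c = 1] and summing over the monomials
    of [P] concludes. *)
Require Import Defs.
From HB Require Import structures.
From mathcomp Require Import all_boot all_order all_algebra.

Set Implicit Arguments.
Unset Strict Implicit.
Unset Printing Implicit Defensive.

Import GRing.Theory.
Local Open Scope ring_scope.

Section CvMulr.
Variables (R : pzRingType) (n : nat).
Implicit Types (u v : 'cV[R]_n) (b c : R).

Lemma cv_mulrDl u v b : cv_mulr (u + v) b = cv_mulr u b + cv_mulr v b.
Proof. by apply/colP => i; rewrite !mxE mulrDl. Qed.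

Lemma cv_mulrA v b c : cv_mulr (cv_mulr v b) c = cv_mulr v (b * c).
Proof. by apply/colP => i; rewrite !mxE mulrA. Qed.

Lemma cv_mulr1 v : cv_mulr v 1 = v.
Proof. by apply/colP => i; rewrite !mxE mulr1. Qed.

Lemma mulmx_cv_mulr (A : 'M[R]_n) v b : A *m cv_mulr v b = cv_mulr (A *m v) b.
Proof.
apply/colP => i; rewrite !mxE mulr_suml.
by apply: eq_bigr => j _; rewrite mxE mulrA.
Qed.
End CvMulr.

(** Remainders are unique: the polynomials [L] with [lin_eval L v 1 = 0] form a left ideal
    containing every [x_i - v_i]. *)
Lemma skew_eval_lin (F : nzRingType) (n : nat)
    (sigma : {rmorphism F -> 'M[F]_n}) (delta : sderivation sigma)
    (P : skew_poly delta) (v : 'cV[F]_n) :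
  skew_eval P v = lin_eval P v 1.
Proof. exact: skew_remainder_uniq (skew_evalP P v). Qed.

Section Conjugation.
Variables (F : unitRingType) (n : nat) (sigma : {rmorphism F -> 'M[F]_n}).
Variables (delta : sderivation sigma) (a : 'cV[F]_n) (b : F).
Hypothesis b_unit : b \is a GRing.unit.
Let v := cv_mulr (skewD delta a b) b^-1.

(** The right factor [b] cancels the [b^-1] in [v]; then [sigma c *m delta b] and
    [cv_mulr (delta c) b] add up to [delta (c * b)]. *)
Lemma skewD_conj c : cv_mulr (skewD delta v c) b = skewD delta a (c * b).
Proof.
rewrite /skewD cv_mulrDl -mulmx_cv_mulr cv_mulrA mulVr // cv_mulr1.
by rewrite sderM rmorphM -mulmxA mulmxDr addrA.
Qed.

Lemma skewD_mon_conj m c :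
  skewD_mon delta v m c * b = skewD_mon delta a m (c * b).
(* The leading variable is handled by [skewD_conj] at the scalar [skewD_mon delta v m c]. *)
Proof. by elim: m => //= i m <-; rewrite -skewD_conj [RHS]mxE. Qed.

Lemma lin_eval_conj (P : skew_poly delta) c :
  lin_eval P v c * b = lin_eval P a (c * b).
Proof.
rewrite /lin_eval mulr_suml.
by apply: eq_bigr => m _; rewrite -mulrA skewD_mon_conj.
Qed.
End Conjugation.

Theorem theorem1 (F : unitRingType)
    (divF : forall x : F, x != 0 -> x \is a GRing.unit)
    (n : nat) (n_gt0 : (0 < n)%N)
    (sigma : {rmorphism F -> 'M[F]_n}) (delta : sderivation sigma)
    (a : 'cV[F]_n) (beta : F) (beta_neq0 : beta != 0) (P : skew_poly delta) :
  skew_eval P (cv_mulr (skewD delta a beta) beta^-1) =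
  lin_eval P a beta * beta^-1.
Proof.
have beta_unit := divF _ beta_neq0.
(* Cancelling [beta^-1] on the right leaves the conjugation identity at [c = 1]. *)
by apply: (mulIr beta_unit); rewrite skew_eval_lin lin_eval_conj // mul1r mulrVK.
Qed.
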